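(* Let $\Omega$ be a topological signature, let $A$ be a locally compact topological $\Omega$-algebra and let $L$ be a subset of $A$. Then the following two conditions are equivalent: (i) $L$ is clopen and the syntactic congruence $\sigma_L$ is compactly determined; (ii) $\sigma_L$ is clopen (as a subset of $A\times A$).
   Context: A topological signature is a sequence $\Omega=(\Omega_n)_{n\in\mathbb{N}}$ (with $0\in\mathbb{N}$) of topological spaces. An $\Omega$-algebra is a set $A$ with evaluation maps $E_n^A:\Omega_n\times A^n\to A$ ($n\in\mathbb{N}$); for $w\in\Omega_n$ write $w_A(a_1,\ldots,a_n)=E_n^A(w,a_1,\ldots,a_n)$. It is a topological $\Omega$-algebra if $A$ is a topological space and every $E_n^A$ is continuous. Compact and locally compact spaces are required to be Hausdorff; a locally compact algebra is a topological algebra whose underlying space is locally compact. Let $T_\Omega(X)$ be the algebra of $\Omega$-terms over the set of variables $X$. A term is linear in a variable $x$ if $x$ occurs in it exactly once. The translation monoid $M(A)$ is the set of all maps $A\to A$ of the form $a\mapsto t_A(a_1,\ldots,a_{i-1},a,a_{i+1},\ldots,a_m)$, where $t\in T_\Omega(\{x_1,\ldots,x_m\})$ is linear in $x_i$ and $a_j\in A$ ($j\ne i$). The syntactic congruence $\sigma_L$ of $L\subseteq A$ is $\{(a,a')\in A\times A:\forall f\in M(A)\ (f(a)\in L\iff f(a')\in L)\}$; it is the largest congruence on $A$ for which $L$ is a union of classes. $\mathcal{C}(A)$ is the set of continuous maps $A\to A$ with the compact-open topology. For a set $S$ of functions $A\to A$, $\sigma_L$ is $S$-determined if for all $a,a'\in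 A$: $(a,a')\in\sigma_L$ if and only if $\forall f\in S\ (f(a)\in L\iff f(a')\in L)$. $\sigma_L$ is compactly determined if it is $C$-determined for some compact subset $C$ of $\mathcal{C}(A)$. *)

(* Defs.v *)
From mathcomp Require Import all_boot.
From mathcomp Require Import all_classical topology.

Set Implicit Arguments.
Unset Strict Implicit.
Unset Printing Implicit Defensive.

Local Open Scope classical_set_scope.

(* A topological signature is a family [Omega : nat -> topologicalType]; the
   power [A^n] is ['I_n -> A] with the product topology. *)
Definition evaluation (Omega : nat -> topologicalType) (A : topologicalType) :=
  forall n : nat, Omega n * {ptws 'I_n -> A} -> A.

Definition topological_algebra (Omega : nat -> topologicalType)
    (A : topologicalType) (E : evaluation Omega A) : Prop :=
  forall n : nat, continuous (E n).

Definition locally_compact_space (A : topologicalType) : Prop :=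
  hausdorff_space A /\ locally_compact [set: A].

Inductive term (Omega : nat -> topologicalType) (X : Type) : Type :=
| Var of X
| App (n : nat) of Omega n & ('I_n -> term Omega X).

Section Terms.
Context (Omega : nat -> topologicalType).

Fixpoint occurrences (X : eqType) (x : X) (t : term Omega X) : nat :=
  match t with
  | Var y => (y == x : nat)
  | App n _ ts => (\sum_(i < n) occurrences x (ts i))%N
  end.

Definition linear_in (X : eqType) (x : X) (t : term Omega X) : Prop :=
  occurrences x t = 1%N.

Fixpoint eval_term (A : topologicalType) (E : evaluation Omega A) (X : Type)
    (env : X -> A) (t : term Omega X) : A :=
  match t with
  | Var y => env y
  | App n w ts => E n (w, fun i => eval_term E env (ts i))
  end.

(* The tuple (a_1, ..., a_{i-1}, x, a_{i+1}, ..., a_m); only the entries a_j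
   with j != i are given, so that the identity is a translation even when [A]
   is empty. *)
Definition plug (A : Type) (m : nat) (i : 'I_m) (a : {j : 'I_m | j != i} -> A)
    (x : A) : 'I_m -> A :=
  fun j => oapp a x (insub j).

Definition translation_monoid (A : topologicalType) (E : evaluation Omega A) :
    set (A -> A) :=
  [set f | exists (m : nat) (i : 'I_m) (t : term Omega 'I_m)
                  (a : {j : 'I_m | j != i} -> A),
     linear_in i t /\ f = (fun x => eval_term E (plug a x) t)].

Definition syntactic_congruence (A : topologicalType) (E : evaluation Omega A)
    (L : set A) : set (A * A) :=
  [set p | forall f, translation_monoid E f -> (L (f p.1) <-> L (f p.2))].

Definition determined (A : topologicalType) (E : evaluation Omega A)
    (L : set A) (S : set (A -> A)) : Prop :=
  forall a a' : A, syntactic_congruence E L (a, a') <->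
    (forall f, S f -> (L (f a) <-> L (f a'))).

Section CompactlyDetermined.
(* Makes the compact-open topology the canonical one on [continuousType A A]. *)
Import ArrowAsCompactOpen.

Definition compactly_determined (A : topologicalType) (E : evaluation Omega A)
    (L : set A) : Prop :=
  exists C : set (continuousType A A),
    compact C /\ determined E L [set (g : A -> A) | g in C].

End CompactlyDetermined.

End Terms.

(* Main.v *)
Require Import Defs.
From mathcomp Require Import all_boot.
From mathcomp Require Import all_classical topology.

Local Open Scope classical_set_scope.

(** Why the theorem holds.

    Suppose that [L] is clopen and that a compact set [C] of continuous maps
    determines the syntactic congruence.  Since [A] is locally compact
    Hausdorff, evaluation [(g, a) |-> g a] is jointly continuous for the
    compact-open topology, so that the condition [L (g a) <-> L (g a')] is
    clopen in [(g, (a, a'))].  Universal quantification over a parameter that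
    runs through a compact set preserves clopen sets (the tube lemma gives
    openness), hence the congruence is clopen: [clopen_forall_compact] and
    [clopen_agree_compact].

    Conversely, if the congruence is clopen then its classes are open, and so
    are [L] and its complement, as unions of classes.  A determining set may
    consist of arbitrary continuous maps, which leaves room for very simple ones.
    If some [l] is in [L] and some [m] is not, take all maps [A -> A] that are
    constant on classes and have values in [{l, m}].  They are continuous
    because the classes are open, and the map sending the class of [a] to [l]
    and all other points to [m] tells [a] from everything outside its class.
    They form a compact set because a compact subset of [A] meets only finitely
    many classes, so that on this set the compact-open topology is that of the
    Cantor cube of maps from the set of classes to [{l, m}]
    ([compact_invariant_maps]).  If [L] is empty or the whole of [A], all points
    are congruent and the empty set of maps determines the congruence. *)

(** Openness is the tube lemma, in the form of the near-covering
    characterization of compactness; closedness is an intersection of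
    closed sets. *)
Lemma clopen_forall_compact {I X : topologicalType} (K : set I)
    (Z : set (I * X)) :
  compact K -> clopen Z -> clopen [set x | forall i, K i -> Z (i, x)].
Proof.
move=> cK [oZ cZ]; split.
  rewrite openE => x Zx.
  move/compact_near_coveringP: cK => /(_ _ (nbhs x) (fun y i => Z (i, y))).
  apply=> i /Zx Zix; move: oZ; rewrite openE => /(_ _ Zix) [[P Q] /= PQ PQZ].
  by exists (P, Q) => // -[j y] /= [Pj Qy]; exact: (PQZ (j, y)).
rewrite (_ : [set x | _] = \bigcap_(i in K) (pair i @^-1` Z)); last first.
  by rewrite eqEsubset; split.
apply: closed_bigI => i _; apply: preimage_closed => // x _.
by apply: cvg_pair => /=; [exact: cvg_cst | exact: cvg_id].
Qed.

Lemma clopen_iff {X : topologicalType} (P Q : set X) :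
  clopen P -> clopen Q -> clopen [set x | P x <-> Q x].
Proof.
move=> cP cQ.
have -> : [set x | P x <-> Q x] = (P `&` Q) `|` (~` P `&` ~` Q).
  rewrite eqEsubset; split => x /=.
    by have [Px|nPx] := pselect (P x); [left|right]; tauto.
  by tauto.
by apply: clopenU; apply: clopenI => //; apply: clopenC.
Qed.

Lemma locally_compact_regular (A : topologicalType) :
  locally_compact_space A -> regular_space A.
Proof.
move=> [hA lA] x; have [B] := lA x I; rewrite withinET => Bx [cB _].
exact: (compact_regular _ cB).
Qed.

Section CompactOpen.
Import ArrowAsCompactOpen.

(** Local compactness of [A] enters through the joint continuity of
    evaluation. *)
Lemma clopen_agree_compact {A Y : topologicalType} (L : set Y)
    (C : set (continuousType A Y)) :
  locally_compact_space A -> clopen L -> compact C ->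
  clopen [set p : A * A | forall g, C g -> (L (g p.1) <-> L (g p.2))].
Proof.
move=> lA cL cC.
have cev : continuous (@eval A Y).
  by apply: eval_continuous; [exact: lA.2 | exact: locally_compact_regular].
have cevp (pr : A * A -> A) : continuous pr ->
    clopen [set q : continuousType A Y * (A * A) | L (eval (q.1, pr q.2))].
  move=> cpr; pose ev q : Y := @eval A Y (q.1, pr q.2).
  apply: (@preimage_clopen _ _ ev) cL _ => q.
  apply: (@continuous_comp _ _ _
    (fun q : continuousType A Y * (A * A) => (q.1, pr q.2)) (@eval A Y));
    last exact: cev.
  apply: (@cvg_pair _ _ _ (nbhs q) (nbhs q.1) (nbhs (pr q.2)));
    first exact: cvg_fst.
  by apply: continuous_comp; [exact: cvg_snd | exact: cpr].
pose Z : set (continuousType A Y * (A * A)) :=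
  [set q | L (eval (q.1, q.2.1)) <-> L (eval (q.1, q.2.2))].
have cZ : clopen Z.
  by apply: clopen_iff; apply: cevp => p; [exact: cvg_fst | exact: cvg_snd].
exact: clopen_forall_compact cC cZ.
Qed.

(** A set or its complement has a preimage in [F], so the image filter has
    no proper refinement. *)
Lemma fmap_ultra {T U : Type} (f : T -> U) (F : set_system T) :
  UltraFilter F -> UltraFilter (f @ F).
Proof.
move=> FU; split; first exact: fmap_proper_filter.
move=> G PG FG; rewrite eqEsubset; split=> // B GB.
have [//|nFB] := in_ultra_setVsetC (f @^-1` B) FU.
have [y [By nBy]] := filter_ex (filterI GB (FG _ nFB : G (~` B))).
by case: nBy.
Qed.

Lemma continuous_invariant {A Y : topologicalType} (s : A -> set A) (f : A -> Y) :
  (forall x, nbhs x (s x)) -> (forall x y, s x y -> f x = f y) -> continuous f.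
Proof.
move=> ns fs x U Ufx; apply: filterS (ns x) => y /fs /= fxy.
by rewrite -fxy; exact: nbhs_singleton.
Qed.

(** A form of Tychonoff's theorem in which the local constancy of the maps
    replaces equicontinuity.  Along an ultrafilter, such maps converge pointwise
    to a map [h] that is again invariant under [s].  On each neighborhood [s x]
    all the maps agree with their value at [x], so that convergence at [x] is
    convergence on all of [s x]; covering a compact set by such neighborhoods turns pointwise
    convergence into convergence in the compact-open topology. *)
Lemma compact_invariant_maps {A Y : topologicalType} (s : A -> set A)
    (D : set Y) :
  (forall x, nbhs x (s x)) -> compact D ->
  compact [set g : continuousType A Y |
    (forall x, D (g x)) /\ forall x y, s x y -> g x = g y].
Proof.
move=> ns; set C := [set g | _]; rewrite !compact_ultra => cD F FU FC.
have [g0 [_ g0s]] := filter_ex FC.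
pose lim x := [set y | D y /\ (fun g : continuousType A Y => g x) @ F --> y].
have limP x : lim x !=set0.
  apply: cD; first exact: fmap_ultra.
  suff : F [set g : continuousType A Y | D (g x)] by [].
  by apply: filterS FC => g [gD _]; exact: gD.
(* [Y] need not be Hausdorff, so limits are chosen.  The choice depends only on
   the set of limits and on the default value, both of which are the same at
   related points. *)
pose h x := xget (g0 x) (lim x).
have hP x : lim x (h x) by exact: (xgetPex _ (limP x)).
have evS (B : set Y) u v : (forall g, C g -> g u = g v) ->
    F [set g : continuousType A Y | B (g u)] ->
    F [set g : continuousType A Y | B (g v)].
  by move=> uv FB; apply: filterS (filterI FC FB) => g [/uv /= <-].
have hs x y : s x y -> h x = h y.
  move=> sxy; rewrite /h (g0s _ _ sxy); congr xget.
  rewrite /lim; congr (fun G : set_system Y => [set y | D y /\ G --> y]).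
  by rewrite eqEsubset; split=> B; apply: evS => g [_ gs]; rewrite (gs _ _ sxy).
have hc := continuous_invariant s h ns hs.
pose h' : continuousType A Y := mkcts hc.
exists h'; split; first by split=> [x|//]; case: (hP x).
move=> U /= [_ [[W oW <-] /= Wh WU]]; apply: (filterS WU).
have /(_ W) : (fun g : continuousType A Y => (g : {compact-open, A -> Y})) @ F
    --> (h : {compact-open, A -> Y}).
  apply/compact_open_cvgP => K O cK oO hKO.
  have Ohx x : K x -> F [set g : continuousType A Y | O (g x)].
    move=> Kx; apply: (hP x).2; apply: open_nbhs_nbhs; split=> //.
    by apply: hKO; exists x.
  move/compact_near_coveringP: cK =>
    /(_ _ F (fun (g : continuousType A Y) x => O (g x)) _).
  move=> KO; apply: filterS (KO _) => [g gKO _ [x Kx <-]|x Kx]; first exact: gKO.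
  exists (s x, [set g : continuousType A Y | O (g x)] `&`
    [set g : continuousType A Y | forall x y, s x y -> g x = g y]).
    split; first exact: ns.
    by apply: filterI (Ohx x Kx) _; apply: filterS FC => g [].
  by move=> [y g] /= [sxy [Ogx gs]]; rewrite -(gs _ _ sxy).
apply; exact: open_nbhs_nbhs.
Qed.
End CompactOpen.

Section Congruence.
Context {Omega : nat -> topologicalType} {A : topologicalType}.
Context (E : evaluation Omega A) (L : set A).

(** The identity is the translation given by the term [x_1]. *)
Lemma syntactic_congruence_saturated (a b : A) :
  syntactic_congruence E L (a, b) -> L a <-> L b.
Proof.
suff Mid : translation_monoid E idfun by move=> /(_ _ Mid).
exists 1, ord0, (Var Omega ord0), (fun=> a).
split; first by [].
by apply/funext => x /=; rewrite /plug insubF ?eqxx.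
Qed.

(** Slice an open box around the diagonal point [(x, x)]. *)
Lemma nbhs_syntactic_class :
  clopen (syntactic_congruence E L) ->
  forall x, nbhs x (fun y => syntactic_congruence E L (x, y)).
Proof.
move=> [oS _] x.
have /= : nbhs (x, x) (syntactic_congruence E L).
  by move: oS; rewrite openE; apply.
by case=> -[P Q] /= [Px Qx] PQ; apply: filterS Qx => y Qy; apply: PQ;
  split => //=; exact: nbhs_singleton.
Qed.

Lemma clopen_of_clopen_syntactic :
  clopen (syntactic_congruence E L) -> clopen L.
Proof.
move=> /nbhs_syntactic_class nS; split.
  rewrite openE => x Lx; apply: filterS (nS x) => y.
  by move=> /syntactic_congruence_saturated /= [+ _]; apply.
move=> x clx; have [y [Ly]] := clx _ (nS x).
by move=> /syntactic_congruence_saturated /= [_ +]; apply.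
Qed.

Lemma compactly_determined_of_clopen :
  clopen (syntactic_congruence E L) -> compactly_determined E L.
Proof.
set S := syntactic_congruence E L => cS.
have nS := nbhs_syntactic_class cS.
have [[[l Ll] [m nLm]]|triv] := pselect ((exists l, L l) /\ (exists m, ~ L m)).
  exists [set g : continuousType A A |
    (forall x, [set l; m] (g x)) /\ forall x y, S (x, y) -> g x = g y].
  split.
    apply: (compact_invariant_maps (fun x => [set y | S (x, y)])) => //.
    by apply: compactU; exact: compact_set1.
  move=> a b; split=> [Sab f [g [_ gS] <-]|agree]; first by rewrite (gS _ _ Sab).
  pose f x := if `[< S (a, x) >] then l else m.
  have fS x y : S (x, y) -> f x = f y.
    move=> Sxy; rewrite /f; congr (if _ then _ else _).
    apply: asbool_equiv_eq; split=> Sa h Mh.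
      by have := Sa h Mh; have := Sxy h Mh; rewrite /=; tauto.
    by have := Sa h Mh; have := Sxy h Mh; rewrite /=; tauto.
  have fc := continuous_invariant (fun x => [set y | S (x, y)]) f nS fS.
  pose g : continuousType A A := mkcts fc.
  have /agree : [set (g : A -> A) | g in [set g : continuousType A A |
    (forall x, [set l; m] (g x)) /\ forall x y, S (x, y) -> g x = g y]] f.
    by exists g => //; split=> // x; rewrite /g /= /mkcts /f;
      case: ifP; [left|right].
  rewrite /f (asboolT (_ : S (a, a))); last by [].
  by case: asboolP => // _ [/(_ Ll)].
(* Here [L] is empty or full, so all points are congruent. *)
exists set0; split; first exact: compact0.
move=> a b; split=> [_ f [g []]|_ f _ /=].
have [Lall|/existsNP [m nLm]] := pselect (forall x, L x); first by [].
have nL x : ~ L x by move=> Lx; apply: triv; split; [exists x|exists m].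
by split=> /nL.
Qed.

End Congruence.

Theorem theorem5p9 (Omega : nat -> topologicalType) (A : topologicalType)
    (E : evaluation Omega A) (hE : topological_algebra E)
    (hA : locally_compact_space A) (L : set A) :
  (clopen L /\ compactly_determined E L) <-> clopen (syntactic_congruence E L).
Proof.
split=> [[cL [C [cC dC]]]|cS]; last first.
  split; first exact: clopen_of_clopen_syntactic cS.
  exact: compactly_determined_of_clopen.
rewrite (_ : syntactic_congruence E L =
  [set p | forall g, C g -> (L (g p.1) <-> L (g p.2))]).
  exact: clopen_agree_compact.
rewrite eqEsubset; split=> -[a b] /=.
  by move=> /dC Sab g Cg; apply: Sab; exists g.
by move=> Sab; apply/dC => _ [g Cg <-]; exact: Sab.
Qed.
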